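(* Let $p$ be a prime, $h_1,h_2$ relatively prime positive integers, and $F$ the 2-dimensional Lubin–Tate formal group over $\mathbb{Z}_p$ associated with $(h_1,h_2)$. For every integer $n\ge1$, the field $\mathbb{Q}_p(F[p^n])$ generated over $\mathbb{Q}_p$ by the coordinates of the $p^n$-torsion points of $F$ is a Galois extension of $\mathbb{Q}_p$.
   Context: With $h=h_1+h_2$, let $L=(L_1,L_2)$ with $L_1=x_1+\sum_{k\ge1}p^{-2k}x_1^{p^{kh}}+\sum_{k\ge0}p^{-(2k+1)}x_2^{p^{h_1+kh}}$, $L_2=x_2+\sum_{k\ge1}p^{-2k}x_2^{p^{kh}}+\sum_{k\ge0}p^{-(2k+1)}x_1^{p^{h_2+kh}}$, and $F(X,Y)=L^{-1}(L(X)+L(Y))$, a 2-dimensional formal group with coefficients in $\mathbb{Z}_p$. For $a\in\mathbb{Z}_p$, $[a]_F(X)=L^{-1}(aL(X))$, and $F[p^n]=\{X\in\overline{\mathbb{Q}}_p^{\,2}:[p^n]_F(X)=\vec0\}$. *)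

(* Defs.v *)
From HB Require Import structures.
From mathcomp Require Import all_boot all_order all_algebra.
From mathcomp Require Import reals.
Set Implicit Arguments. Unset Strict Implicit. Unset Printing Implicit Defensive.
Import Order.TTheory GRing.Theory Num.Theory.
Local Open Scope ring_scope.

(* The ambient data: K plays the role of an algebraic closure of Q_p,  *)
(* Q (a subset of K) plays the role of Q_p, abs is the (unique)        *)
(* extension to K of the p-adic absolute value of Q_p.                 *)

Definition is_subfield (K : fieldType) (S : K -> Prop) : Prop :=
  S 0 /\ S 1 /\ (forall x y, S x -> S y -> S (x + y)) /\
  (forall x, S x -> S (- x)) /\ (forall x y, S x -> S y -> S (x * y)) /\
  (forall x, S x -> x != 0 -> S x^-1).

Definition polyOv (K : fieldType) (Q : K -> Prop) (q : {poly K}) : Prop :=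
  forall i, Q q`_i.

(* (R, K, abs, Q) is an algebraic closure of Q_p with the p-adic absolute value:
   abs is a non-archimedean absolute value on the algebraically closed field K of
   characteristic 0; Q is a subfield, complete for abs, in which the rationals are
   dense, with |p| = 1/p; and K is algebraic over Q.  These data determine
   (Q, K, abs) up to isomorphism as (Q_p, \bar Q_p, |.|_p). *)
Definition Qp_closure (R : realType) (K : closedFieldType) (abs : K -> R)
    (Q : K -> Prop) (p : nat) : Prop :=
  [pchar K] =i pred0 /\
  ((forall x, 0 <= abs x) /\ (forall x, abs x = 0 <-> x = 0)) /\
  (forall x y, abs (x * y) = abs x * abs y) /\
  (forall x y, abs (x + y) <= Num.max (abs x) (abs y)) /\
  is_subfield Q /\
  ((forall r : rat, Q (ratr r))
        /\ (forall x eps, Q x -> 0 < eps -> exists r : rat, abs (x - ratr r) < eps)) /\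
      (forall u : nat -> K, (forall n, Q (u n)) ->
         (forall eps, 0 < eps -> exists N, forall m n, (N <= m)%N -> (N <= n)%N ->
              abs (u m - u n) < eps) ->
         exists l, Q l /\ forall eps, 0 < eps -> exists N, forall n, (N <= n)%N ->
              abs (u n - l) < eps) /\
  abs (p%:R) = (p%:R)^-1 /\
  (forall x : K, exists q : {poly K}, [/\ q != 0, polyOv Q q & root q x]).

(* Formal power series in two variables x1, x2: f i j = coefficient   *)
(* of x1^i x2^j.                                                        *)

Definition ps (K : fieldType) := nat -> nat -> K.

Definition psone (K : fieldType) : ps K := fun i j => ((i == 0%N) && (j == 0%N))%:R.
Definition psX1 (K : fieldType) : ps K := fun i j => ((i == 1%N) && (j == 0%N))%:R.
Definition psX2 (K : fieldType) : ps K := fun i j => ((i == 0%N) && (j == 1%N))%:R.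

Arguments psone {K}.
Arguments psX1 {K}.
Arguments psX2 {K}.

Definition psscale (K : fieldType) (c : K) (f : ps K) : ps K := fun i j => c * f i j.

Definition psmul (K : fieldType) (f g : ps K) : ps K := fun i j =>
  \sum_(a < i.+1) \sum_(b < j.+1) f a b * g (i - a)%N (j - b)%N.

Definition psexp (K : fieldType) (f : ps K) (n : nat) : ps K := iter n (psmul f) psone.

(* composition f(g1, g2), for g1, g2 with zero constant term
   (then only monomials a+b <= i+j of f contribute to the coefficient (i,j)) *)
Definition pscomp (K : fieldType) (f g1 g2 : ps K) : ps K := fun i j =>
  \sum_(a < (i + j).+1) \sum_(b < (i + j).+1)
     f a b * psmul (psexp g1 a) (psexp g2 b) i j.

(* The logarithm L = (L1, L2) of the paper, h = h1 + h2.
   L1 = x1 + sum_{k>=1} p^{-2k} x1^{p^{kh}} + sum_{k>=0} p^{-(2k+1)} x2^{p^{h1+kh}} *)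
Definition LT_L1 (K : fieldType) (p h1 h2 : nat) : ps K := fun i j =>
  ((i == 1%N) && (j == 0%N))%:R
  + \sum_(1 <= k < i.+1)
       ((i == p ^ (k * (h1 + h2)))%N && (j == 0%N))%:R * ((p%:R)^-1) ^+ (2 * k)
  + \sum_(k < j.+1)
       ((i == 0%N) && (j == p ^ (h1 + k * (h1 + h2)))%N)%:R * ((p%:R)^-1) ^+ (2 * k + 1).

(* L2 = x2 + sum_{k>=1} p^{-2k} x2^{p^{kh}} + sum_{k>=0} p^{-(2k+1)} x1^{p^{h2+kh}} *)
Definition LT_L2 (K : fieldType) (p h1 h2 : nat) : ps K := fun i j =>
  ((i == 0%N) && (j == 1%N))%:R
  + \sum_(1 <= k < j.+1)
       ((i == 0%N) && (j == p ^ (k * (h1 + h2)))%N)%:R * ((p%:R)^-1) ^+ (2 * k)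
  + \sum_(k < i.+1)
       ((i == p ^ (h2 + k * (h1 + h2)))%N && (j == 0%N))%:R * ((p%:R)^-1) ^+ (2 * k + 1).

Arguments LT_L1 {K} p h1 h2.
Arguments LT_L2 {K} p h1 h2.

Definition LT_Linv (K : fieldType) (p h1 h2 : nat) (G1 G2 : ps K) : Prop :=
  [/\ G1 0%N 0%N = 0, G2 0%N 0%N = 0,
      pscomp (LT_L1 p h1 h2) G1 G2 =2 psX1
    & pscomp (LT_L2 p h1 h2) G1 G2 =2 psX2].

Definition LT_mult (K : fieldType) (p h1 h2 : nat) (a : K) (P1 P2 : ps K) : Prop :=
  exists G1 G2, [/\ LT_Linv p h1 h2 G1 G2,
     P1 =2 pscomp G1 (psscale a (LT_L1 p h1 h2)) (psscale a (LT_L2 p h1 h2))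
   & P2 =2 pscomp G2 (psscale a (LT_L1 p h1 h2)) (psscale a (LT_L2 p h1 h2))].

Definition pspart (K : fieldType) (f : ps K) (x1 x2 : K) (N : nat) : K :=
  \sum_(i < N.+1) \sum_(j < (N - i).+1) f i j * x1 ^+ i * x2 ^+ j.

Definition ps_eval_zero (R : realType) (K : fieldType) (abs : K -> R)
    (f : ps K) (x1 x2 : K) : Prop :=
  forall eps, 0 < eps -> exists M, forall N, (M <= N)%N -> abs (pspart f x1 x2 N) < eps.

Definition LT_torsion (R : realType) (K : fieldType) (abs : K -> R) (p h1 h2 n : nat)
    (x1 x2 : K) : Prop :=
  [/\ abs x1 < 1, abs x2 < 1 &
      exists P1 P2, [/\ LT_mult p h1 h2 (p ^ n)%:R P1 P2,
                        ps_eval_zero abs P1 x1 x2 & ps_eval_zero abs P2 x1 x2]].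

Definition gen_field (K : fieldType) (Q T : K -> Prop) : K -> Prop := fun x =>
  forall S, is_subfield S -> (forall y, Q y -> S y) -> (forall y, T y -> S y) -> S x.

Definition LT_torsion_field (R : realType) (K : fieldType) (abs : K -> R) (Q : K -> Prop)
    (p h1 h2 n : nat) : K -> Prop :=
  gen_field Q (fun y => exists x1 x2, LT_torsion abs p h1 h2 n x1 x2 /\ (y = x1 \/ y = x2)).

Definition irreducible_over (K : fieldType) (Q : K -> Prop) (q : {poly K}) : Prop :=
  [/\ polyOv Q q, (1 < size q)%N &
      forall a b, polyOv Q a -> polyOv Q b -> q = a * b -> size a = 1%N \/ size b = 1%N].

Definition splits_in (K : fieldType) (E : K -> Prop) (q : {poly K}) : Prop :=
  exists (c : K) (rs : seq K), (forall r, r \in rs -> E r) /\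
    q = c%:P * \prod_(r <- rs) ('X - r%:P).

Definition galois_over (K : fieldType) (Q E : K -> Prop) : Prop :=
  [/\ is_subfield E, (forall x, Q x -> E x),
      (forall x, E x -> exists q : {poly K}, [/\ q != 0, polyOv Q q & root q x]),
      (forall x, E x -> exists q : {poly K}, [/\ polyOv Q q, root q x & coprimep q q^`()])
    & (forall q, irreducible_over Q q -> (exists x, E x /\ root q x) -> splits_in E q)].

(* Main.v *)
Require Import Defs.
From HB Require Import structures.
From mathcomp Require Import all_boot all_order all_algebra separable.
From mathcomp Require Import boolp reals ring.
Set Implicit Arguments. Unset Strict Implicit. Unset Printing Implicit Defensive.
Import Order.TTheory GRing.Theory Num.Theory.
Local Open Scope ring_scope.

(** Comparing the coefficients of [L o G = id] degree by degree shows that [L^-1], hence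
    [p^n]_F, has coefficients in [Q].  Let [t'] be a conjugate of [t] over [Q].  Since
    [Q] is complete, the coordinates on the basis 1, t, ..., t^(k-1) of [Q(t)] are bounded
    by the absolute value, so [|c(t')| <= C |c(t)|] for every polynomial [c] over [Q];
    replacing [c] by its powers gives [|c(t')| <= |c(t)|].  So if both coordinates of a
    torsion point are polynomials in [t] (primitive element theorem), replacing [t] by [t']
    gives another torsion point.  Consequently every [x = a(t)] in the torsion field [E] can
    be so written with [a(t')] in [E] for all conjugates [t'], and every conjugate of [x] is
    of the form [a(t')], because the resultant in [T] of the minimal polynomial of [t] and
    [a(T) - X] has coefficients in [Q]. *)

Local Notation "p ^^ f" := (map_poly f p) (at level 30, f at level 30).

(** * Subfields given by predicates, as field types *)

Section SubfieldType.
Variables (K : fieldType) (S : K -> Prop).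
Hypothesis subS : is_subfield S.

Let Sp : pred K := fun x => `[< S x >].

Fact subfield_divring_closed : divring_closed Sp.
Proof.
case: subS => [S0 [S1 [SD [SN [SM SV]]]]].
split=> [|x y /asboolP Sx /asboolP Sy|x y /asboolP Sx /asboolP Sy];
  apply/asboolP => //; first exact/SD/SN.
by have [->|y0] := eqVneq y 0; [rewrite invr0 mulr0 | apply/SM/SV].
Qed.

HB.instance Definition _ :=
  GRing.isDivringClosed.Build K Sp subfield_divring_closed.

Let F := {x : K | x \in Sp}.
HB.instance Definition _ := SubChoice.on F.
HB.instance Definition _ := [SubChoice_isSubIntegralDomain of F by <:].
HB.instance Definition _ := [SubIntegralDomain_isSubField of F by <:].

(** Polynomial division and gcd over the subfield need coefficients in a field type; [iota] then
    embeds it back into [K]. *)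
Lemma subfield_fieldType : exists (L : fieldType) (iota : {rmorphism L -> K}),
  forall x, S x <-> exists a, x = iota a.
Proof.
exists (F : fieldType), (val : {rmorphism F -> K}) => x; split=> [/asboolP Sx|[a ->]].
  by exists (exist _ x Sx).
by apply/asboolP; have := valP a.
Qed.

End SubfieldType.

(** Stands for an embedding of [F(x)] over [F] sending [x] to [y]. For algebraic [x] it is
    symmetric, the minimal polynomial being irreducible. *)
Definition conjugate (F K : fieldType) (iota : {rmorphism F -> K}) (x y : K) :=
  forall r : {poly F}, root (r ^^ iota) x -> root (r ^^ iota) y.

(** * Minimal polynomials and conjugate elements *)

Section Conjugates.
Variables (F K : fieldType) (iota : {rmorphism F -> K}).
Implicit Types (x y t : K) (a b r : {poly F}).

Lemma map_horner_comp r a t :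
  ((r \Po a) ^^ iota).[t] = (r ^^ iota).[(a ^^ iota).[t]].
Proof. by rewrite map_comp_poly horner_comp. Qed.

(** An annihilator [r] that is not a multiple of [q] leaves a nonzero remainder of smaller size
    still vanishing at [x], and this descent stops. *)
Lemma minimal_poly_exists x : algebraicOver iota x ->
  exists f : {poly F}, [/\ f != 0, root (f ^^ iota) x &
    forall r, root (r ^^ iota) x -> f %| r].
Proof.
case=> q nz_q qx; have [m] := ubnP (size q).
elim: m => // m IHm in q nz_q qx *; rewrite ltnS => le_qm.
have [[r [rx ndv]]|nex] := pselect (exists r, root (r ^^ iota) x /\ ~~ (q %| r)).
  apply: (IHm (r %% q)) => //; last by apply: leq_trans le_qm; rewrite ltn_modp.
  have := rx; rewrite /root {1}(divp_eq r q) rmorphD rmorphM /= hornerD hornerM.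
  by rewrite (rootP qx) mulr0 add0r.
by exists q; split=> // r rx; apply: contrapT => /negP ndv; apply: nex; exists r.
Qed.

Lemma conjugate_horner a t t' : conjugate iota t t' ->
  conjugate iota (a ^^ iota).[t] (a ^^ iota).[t'].
Proof.
by move=> ctt' r; rewrite /root -!map_horner_comp; apply: ctt'.
Qed.

(** Write [f] as [q] times the gcd: [t] is a root of one factor. If of [q], then [f] divides [q] and
    the gcd is constant; if of the gcd, then [a] vanishes at [t], which is excluded. *)
Lemma minimal_poly_coprime f t a : f != 0 -> root (f ^^ iota) t ->
    (forall r, root (r ^^ iota) t -> f %| r) -> ~~ root (a ^^ iota) t ->
  coprimep f a.
Proof.
move=> nz_f ft minf nz_at; have /dvdpP[q Df] := dvdp_gcdl f a.
have := ft; rewrite {1}Df rmorphM /= rootM => /orP[/minf fq|gt].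
  have nz_q : q != 0 by apply: contraNneq nz_f => q0; rewrite Df q0 mul0r.
  have nz_g : gcdp f a != 0 by rewrite gcdp_eq0 (negPf nz_f).
  have := dvdp_leq nz_q fq; rewrite {1}Df size_mul // /coprimep.
  rewrite (polySpred nz_g) addnS /= eqSS -leqn0 -{2}[size q]addn0.
  by rewrite leq_add2l.
have /dvdpP[q' Da] := dvdp_gcdr f a.
by rewrite Da rmorphM /= rootM gt orbT in nz_at.
Qed.

Lemma horner_inv t a : algebraicOver iota t -> (a ^^ iota).[t] != 0 ->
  exists b, ((a * b) ^^ iota).[t] = 1.
Proof.
case/minimal_poly_exists=> f [nz_f ft minf] nz_at.
have /Bezout_coprimepP[[u v] /= E] : coprimep f a by apply: minimal_poly_coprime nz_at.
move: E; rewrite -size_poly_eq1 => /size_poly1P[c nz_c Dc].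
exists (c^-1 *: v); rewrite -scalerAr mulrC -[v * a](addKr (u * f)) Dc.
rewrite map_polyZ hornerZ rmorphD rmorphN rmorphM /= hornerD hornerN hornerM.
by rewrite (rootP ft) mulr0 oppr0 add0r map_polyC hornerC -rmorphM mulVf ?rmorph1.
Qed.

Lemma minimal_poly_separable f t : [pchar F] =i pred0 ->
    f != 0 -> root (f ^^ iota) t -> (forall r, root (r ^^ iota) t -> f %| r) ->
  coprimep f f^`().
Proof.
move=> /pcharf0P ch0 nz_f ft minf; apply: (minimal_poly_coprime nz_f ft minf).
apply/negP => /minf ff'; have nz_f' : f^`() != 0.
  have : (1 < size f)%N.
    by rewrite -(size_map_poly iota) (root_size_gt1 _ ft) ?map_poly_eq0.
  case sz_f : (size f) => [|[|m]] // _.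
  (* The coefficient of index [m] in the derivative is [m+1] times the leading coefficient of [f],
     nonzero in characteristic 0. *)
  apply: contraNneq nz_f => f'0; have := coef_deriv f m; rewrite f'0 coef0.
  by move/esym/eqP; rewrite -mulr_natr mulf_eq0 ch0 orbF -lead_coef_eq0 lead_coefE sz_f.
by have := dvdp_leq nz_f' ff'; rewrite leqNgt lt_size_deriv.
Qed.

Lemma primitive_element_pair x y : [pchar F] =i pred0 ->
  algebraicOver iota x -> algebraicOver iota y ->
  exists t a b, (a ^^ iota).[t] = x /\ (b ^^ iota).[t] = y.
Proof.
move=> ch0 [p nz_p px] [q nz_q qy].
have [n [[a Da] [b Db]]] := pchar0_PET nz_p px nz_q qy ch0.
by exists (y *+ n - x), a, b.
Qed.
End Conjugates.

(** * Lifting conjugates through a polynomial, by a resultant *)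

Section Lift.
Variables (F : fieldType) (K : closedFieldType) (iota : {rmorphism F -> K}).
Implicit Types (x y t : K) (a b r : {poly F}).

Lemma lift_conjugate a t y :
    algebraicOver iota t -> conjugate iota (a ^^ iota).[t] y ->
  exists2 t', conjugate iota t t' & (a ^^ iota).[t'] = y.
Proof.
case/minimal_poly_exists=> f [nz_f ft minf] cxy.
(* Adding a multiple of [f] of large degree keeps the values at the roots of [f] and makes [a1]
   nonconstant. The leading coefficient of [a1(T) - X] in [T] is then free of [X], so specializing
   [X] commutes with the resultant. *)
have [a1 [a1E sz_a1]] : exists a1 : {poly F},
    (forall s, root (f ^^ iota) s -> (a1 ^^ iota).[s] = (a ^^ iota).[s])
    /\ (1 < size a1)%N.
  exists (a + f * 'X^((size a).+1)); split=> [s fs|].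
    by rewrite rmorphD rmorphM /= hornerD hornerM (rootP fs) mul0r addr0.
  have sz_f : (0 < size f)%N by rewrite size_poly_gt0.
  by rewrite addrC size_polyDl size_mulXn // addSn ltnS ?leq_addr // addn_gt0 sz_f orbT.
(* The outer variable is [T], eliminated by the resultant; the inner one is [X]. *)
pose f2 : {poly {poly F}} := f ^^ polyC.
pose g2 : {poly {poly F}} := a1 ^^ polyC - 'X%:P.
have lead_f2 : lead_coef f2 = (lead_coef f)%:P.
  by rewrite lead_coef_map_inj //; exact: polyC_inj.
have lead_g2 : lead_coef g2 = (lead_coef a1)%:P.
  rewrite /g2 lead_coefDl ?lead_coef_map_inj //; first exact: polyC_inj.
  by rewrite size_polyN size_map_inj_poly ?(leq_ltn_trans (size_polyC_leq1 _)) //;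
    exact: polyC_inj.
have commF z : commr_rmorph iota z by move=> c; apply: mulrC.
pose ev z : {rmorphism {poly F} -> K} := horner_morph (commF z).
have nz_a1 : a1 != 0 by rewrite -size_poly_gt0 ltnW.
have evC z p : (p ^^ polyC) ^^ (ev z) = p ^^ iota.
  by rewrite -map_poly_comp; apply: eq_map_poly => c; apply: horner_morphC.
have res z : root ((resultant f2 g2) ^^ iota) z
    = (size (gcdp (f ^^ iota) (a1 ^^ iota - z%:P)) > 1)%N.
  rewrite -resultant_eq0 /root -[_.[z]]/(ev z _) map_resultant.
  - by rewrite /g2 rmorphB /= !evC map_polyC /= horner_morphX.
  - by rewrite lead_f2 /= horner_morphC fmorph_eq0 lead_coef_eq0.
  by rewrite lead_g2 /= horner_morphC fmorph_eq0 lead_coef_eq0.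
have := cxy (resultant f2 g2); rewrite !res => szy.
have /szy szgt1 : (1 < size (gcdp (f ^^ iota)
     (a1 ^^ iota - ((a ^^ iota).[t])%:P)))%N.
  apply: (@root_size_gt1 _ t).
    by rewrite gcdp_eq0 map_poly_eq0 (negPf nz_f).
  by rewrite root_gcd ft /root !hornerE a1E ?subrr.
have /closed_rootP[t'] : size (gcdp (f ^^ iota) (a1 ^^ iota - y%:P)) != 1%N.
  by rewrite neq_ltn szgt1 orbT.
rewrite root_gcd => /andP[ft']; rewrite /root !hornerE subr_eq0 a1E // => /eqP Dy.
exists t' => // r /minf /dvdpP[q ->].
by rewrite rmorphM /= rootM ft' orbT.
Qed.
End Lift.

(** * Removing a constant factor by taking powers *)

Lemma bernoulli (R : realDomainType) (x : R) n : 0 <= x -> 1 + n%:R * x <= (1 + x) ^+ n.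
Proof.
move=> x0; elim: n => [|n IHn]; first by rewrite mul0r addr0 expr0.
rewrite exprS (le_trans _ (ler_wpM2l _ IHn)) ?addr_ge0 //.
have -> : (1 + x) * (1 + n%:R * x) = 1 + n.+1%:R * x + n%:R * (x * x) by ring.
by rewrite lerDl !mulr_ge0.
Qed.

(** If [y > x > 0], the powers of [y / x] exceed every [C] by Bernoulli; for [x = 0] the case
    [m = 1] suffices. *)
Lemma ler_of_expM_bound (R : archiRealFieldType) (x y C : R) :
  0 <= x -> 0 <= y -> (forall m, y ^+ m <= C * x ^+ m) -> y <= x.
Proof.
move=> x0 y0 bnd; rewrite leNgt; apply/negP => lt_xy.
have [x_eq0|nz_x] := eqVneq x 0.
  by have := bnd 1%N; rewrite !expr1 x_eq0 mulr0 leNgt -x_eq0 lt_xy.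
have x_gt0 : 0 < x by rewrite lt_def nz_x.
pose d := y / x - 1; have d_gt0 : 0 < d by rewrite subr_gt0 ltr_pdivlMr ?mul1r.
have bnd' m : (1 + d) ^+ m <= C.
  by rewrite addrC subrK expr_div_n ler_pdivrMr ?exprn_gt0.
pose m := Num.bound `|C / d|.
have : C < m%:R * d.
  by rewrite -ltr_pdivrMr // (le_lt_trans (ler_norm _)) // archi_boundP.
rewrite ltNge => /negP; apply; apply: le_trans (bnd' m).
by rewrite (le_trans _ (bernoulli _ (ltW d_gt0))) // lerDr.
Qed.

(** * Non-archimedean estimates over a complete field *)

Section NonArchimedean.
Variables (R : realType) (K : fieldType) (abs : K -> R).
Hypothesis abs_ge0 : forall x, 0 <= abs x.
Hypothesis abs_eq0 : forall x, abs x = 0 <-> x = 0.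
Hypothesis absM : forall x y, abs (x * y) = abs x * abs y.
Hypothesis absD : forall x y, abs (x + y) <= Num.max (abs x) (abs y).

Lemma abs0 : abs 0 = 0. Proof. exact/abs_eq0. Qed.

Lemma abs_gt0 x : x != 0 -> 0 < abs x.
Proof.
by move=> nz_x; rewrite lt_def abs_ge0 andbT; apply: contra_neq nz_x => /abs_eq0.
Qed.

Lemma abs1 : abs 1 = 1.
Proof.
have := abs_gt0 (oner_neq0 K); rewrite lt0r => /andP[nz _].
by apply: (mulfI nz); rewrite -absM !mulr1.
Qed.

Lemma absN x : abs (- x) = abs x.
Proof.
suff E : abs (-1) = 1 by rewrite -mulN1r absM E mul1r.
by apply/eqP; rewrite -(@eqrXn2 _ 2) ?abs_ge0 // expr2 -absM mulrNN mulr1 abs1 expr1n.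
Qed.

Lemma absX x n : abs (x ^+ n) = abs x ^+ n.
Proof. by elim: n => [|n IHn]; rewrite ?abs1 // !exprS absM IHn. Qed.

Lemma absD_le B x y : abs x <= B -> abs y <= B -> abs (x + y) <= B.
Proof. by move=> xB yB; rewrite (le_trans (absD _ _)) // ge_max xB yB. Qed.

Lemma absD_lt B x y : abs x < B -> abs y < B -> abs (x + y) < B.
Proof. by move=> xB yB; rewrite (le_lt_trans (absD _ _)) // gt_max xB yB. Qed.

Lemma abs_sum_le B n (u : 'I_n -> K) : 0 <= B ->
  (forall i, abs (u i) <= B) -> abs (\sum_(i < n) u i) <= B.
Proof.
by move=> B0 uB; apply: (big_ind (fun x => abs x <= B)) => [|x y|//];
  [rewrite abs0 | exact: absD_le].
Qed.

Variables (F : fieldType) (iota : {rmorphism F -> K}).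
Hypothesis complete : forall u : nat -> F,
  (forall eps : R, 0 < eps -> exists N, forall m n, (N <= m)%N -> (N <= n)%N ->
     abs (iota (u m) - iota (u n)) < eps) ->
  exists l, forall eps : R, 0 < eps -> exists N, forall n, (N <= n)%N ->
     abs (iota (u n) - iota l) < eps.

Definition free_family (k : nat) (e : nat -> K) :=
  forall c : nat -> F, \sum_(i < k) iota (c i) * e i = 0 ->
  forall i, (i < k)%N -> c i = 0.

Lemma free_family_widen k e : free_family k.+1 e -> free_family k e.
Proof.
move=> fr c sum0 i lt_ik.
have := fr (fun j => if j == k then 0 else c j).
rewrite big_ord_recr /= eqxx rmorph0 mul0r addr0.
under eq_bigr => j _ do rewrite (ltn_eqF (ltn_ord j)).
by move=> /(_ sum0 i (ltnW lt_ik)); rewrite (ltn_eqF lt_ik).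
Qed.

Lemma limits_uniform (k : nat) (c : nat -> nat -> F) (l : nat -> F) :
    (forall i, (i < k)%N -> forall eps : R, 0 < eps -> exists N, forall n, (N <= n)%N ->
       abs (iota (c n i) - iota (l i)) < eps) ->
  forall eps : R, 0 < eps -> exists N, forall n, (N <= n)%N ->
     forall i, (i < k)%N -> abs (iota (c n i) - iota (l i)) < eps.
Proof.
move=> cvg eps eps0; elim: k cvg => [|k IHk] cvg; first by exists 0%N.
have [N1 HN1] := IHk (fun i lik => cvg i (ltnW lik)).
have [N2 HN2] := cvg k (ltnSn k) eps eps0.
exists (maxn N1 N2) => n; rewrite geq_max => /andP[le1 le2] i.
by rewrite ltnS leq_eqVlt => /orP[/eqP->|lik]; [apply: HN2 | apply: HN1].
Qed.

(* The span of the first [k] vectors is complete by induction, hence closed, so that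
   the next vector stays at positive distance from it. *)
Lemma coord_bounded k e : free_family k e ->
  exists2 C, 0 <= C & forall (c : nat -> F) i, (i < k)%N ->
    abs (iota (c i)) <= C * abs (\sum_(j < k) iota (c j) * e j).
Proof.
elim: k => [|k IHk] fr; first by exists 0.
have [C C0 bndC] := IHk (free_family_widen fr).
(* [d] bounds from below the distance of [e k] to the span of the previous vectors. Without such a
   bound, combinations of these converge to [- e k]. *)
have [d d0 bndd] : exists2 d, 0 < d & forall c : nat -> F,
    d <= abs (e k + \sum_(j < k) iota (c j) * e j).
  apply: contrapT => nex.
  have /choice[c Hc] : forall n : nat, exists c : nat -> F,
      abs (e k + \sum_(j < k) iota (c j) * e j) < n.+1%:R^-1.
    move=> n; apply: contrapT => nc; apply: nex; exists n.+1%:R^-1.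
      by rewrite invr_gt0 ltr0Sn.
    by move=> c; rewrite leNgt; apply/negP => lt; apply: nc; exists c.
  have small eps : 0 < eps -> exists N : nat, forall n, (N <= n)%N ->
      abs (e k + \sum_(j < k) iota (c n j) * e j) < eps.
    move=> eps0; exists (Num.bound eps^-1) => n leNn; apply: lt_le_trans (Hc n) _.
    rewrite invf_ple ?posrE ?ltr0Sn // (le_trans _ (_ : (Num.bound eps^-1)%:R <= _)) //.
      by rewrite ltW // archi_boundP // invr_ge0 ltW.
    by rewrite ler_nat leqW.
  (* Differences of approximations lie in the span of the first [k] vectors, where the induction
     bound turns smallness into Cauchy coordinates. *)
  have diff m n : \sum_(j < k) iota (c m j - c n j) * e j =
      (e k + \sum_(j < k) iota (c m j) * e j) - (e k + \sum_(j < k) iota (c n j) * e j).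
    rewrite opprD addrACA subrr add0r -sumrB.
    by apply: eq_bigr => j _; rewrite rmorphB mulrBl.
  have /choice[l Hl] : forall i, exists l, (i < k)%N -> forall eps : R, 0 < eps ->
      exists N, forall n, (N <= n)%N -> abs (iota (c n i) - iota l) < eps.
    move=> i; have [lik|] := ltnP i k; last by exists 0.
    have [|l Hl] := complete (u := fun n => c n i); last by exists l.
    move=> eps eps0.
    (* [C] may be 0, hence the divisor [C + 1]. *)
    have eps1 : 0 < eps / (C + 1) by rewrite divr_gt0 // ltr_wpDl.
    have [N HN] := small _ eps1; exists N => m n leNm leNn.
    rewrite -rmorphB; apply: le_lt_trans (bndC (fun j => c m j - c n j) i lik) _.
    rewrite diff; set z := _ - _; have zlt : abs z < eps / (C + 1).
      by apply: absD_lt; rewrite ?absN HN.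
    rewrite ltr_pdivlMr ?ltr_wpDl // in zlt; apply: le_lt_trans zlt.
    by rewrite mulrC ler_wpM2l // lerDl.
  pose B := \sum_(j < k) abs (e j) + 1.
  have B0 : 0 < B by rewrite ltr_wpDl // sumr_ge0.
  have eB j : (j < k)%N -> abs (e j) <= B.
    move=> ljk; rewrite /B (bigD1 (Ordinal ljk)) //= -addrA lerDl addr_ge0 //.
    by rewrite sumr_ge0.
  have lim0 : e k + \sum_(j < k) iota (l j) * e j = 0.
    apply/abs_eq0/eqP; apply: contraT => nz.
    have pos : 0 < abs (e k + \sum_(j < k) iota (l j) * e j).
      by rewrite lt_def nz abs_ge0.
    have [N1 HN1] := small _ pos.
    have [N2 HN2] := limits_uniform Hl (divr_gt0 pos B0).
    pose n := maxn N1 N2.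
    (* If the limit [z] were nonzero, it would be [(z - z_n) + z_n] with both terms smaller than
       [|z|] for large [n]; the ultrametric inequality then gives [|z| < |z|]. *)
    have := ltxx (abs (e k + \sum_(j < k) iota (l j) * e j)).
    rewrite -{1}[e k + _](subrK (e k + \sum_(j < k) iota (c n j) * e j)) => <-.
    apply: absD_lt; last by rewrite HN1 ?leq_maxl.
    rewrite opprD addrACA subrr add0r -sumrB.
    apply: (big_ind (fun x => abs x < _)) => [|x y|j _]; first by rewrite abs0.
      exact: absD_lt.
    rewrite -mulrBl absM -absN opprB.
    apply: le_lt_trans (ler_wpM2l (abs_ge0 _) (eB _ (ltn_ord j))) _.
    by rewrite -ltr_pdivlMr // HN2 ?leq_maxr.
  have := fr (fun j => if j == k then 1 else l j).
  rewrite big_ord_recr /= eqxx rmorph1 mul1r addrC.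
  under eq_bigr => j _ do rewrite (ltn_eqF (ltn_ord j)).
  by move=> /(_ lim0 k (ltnSn k)) /eqP; rewrite eqxx oner_eq0.
pose D := d^-1; have D0 : 0 <= D by rewrite invr_ge0 ltW.
pose M := 1 + D * abs (e k); have M0 : 0 <= M by rewrite addr_ge0 ?mulr_ge0.
(* Dividing by [c k] leaves [e k] plus a combination of the previous vectors, of absolute value at
   least [d]. *)
have ck_bnd (c : nat -> F) :
    abs (iota (c k)) <= D * abs (\sum_(j < k.+1) iota (c j) * e j).
  rewrite big_ord_recr /= addrC.
  have [->|nz] := eqVneq (c k) 0; first by rewrite rmorph0 abs0 mulr_ge0.
  have nzi : iota (c k) != 0 by rewrite fmorph_eq0.
  have -> : iota (c k) * e k + \sum_(j < k) iota (c j) * e j =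
      iota (c k) * (e k + \sum_(j < k) iota (c j / c k) * e j).
    rewrite mulrDr mulr_sumr; congr (_ + _); apply: eq_bigr => j _.
    by rewrite fmorph_div mulrA mulrCA divff // mulr1.
  rewrite absM mulrCA ler_peMr //.
  rewrite /D mulrC ler_pdivlMr // mul1r.
  exact: (bndd (fun j => c j / c k)).
(* The index [k] needs only [D]. For [i < k], the induction bound is applied to [S - c_k e_k], of
   absolute value at most [M * |S|]. *)
exists (D + C * M) => [|c i]; first by rewrite addr_ge0 ?mulr_ge0.
set S := \sum_(j < k.+1) _; rewrite ltnS leq_eqVlt => /orP[/eqP->|lik].
  by apply: le_trans (ck_bnd c) _; rewrite ler_wpM2r // lerDl mulr_ge0.
apply: le_trans (bndC c i lik) _.
rewrite (le_trans (_ : _ <= C * M * abs S)) //; last first.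
  by rewrite ler_wpM2r // lerDr.
rewrite -mulrA ler_wpM2l //.
have -> : \sum_(j < k) iota (c j) * e j = S - iota (c k) * e k.
  by rewrite /S big_ord_recr /= addrK.
apply: absD_le; first by rewrite ler_peMl // lerDl mulr_ge0.
rewrite absN absM mulrDl mul1r -mulrA [X in D * X]mulrC mulrA.
by rewrite (le_trans (ler_wpM2r _ (ck_bnd c))) // lerDr.
Qed.

(** Modulo [f], the values at [t] and [t'] have the same coordinates on the powers below [k]. This
    bounds one by [C * B] times the other, where [B] controls the powers of [t']. *)
Lemma conjugate_abs_le (t t' : K) (c : {poly F}) :
    algebraicOver iota t -> conjugate iota t t' ->
  abs (c ^^ iota).[t'] <= abs (c ^^ iota).[t].
Proof.
move=> /minimal_poly_exists[f [nz_f ft minf]] ctt'.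
have hornerE k s (a : {poly F}) : (size a <= k)%N ->
    (a ^^ iota).[s] = \sum_(i < k) iota a`_i * s ^+ i.
  move=> le_ak; rewrite (@horner_coef_wide _ k) ?size_map_poly //.
  by apply: eq_bigr => i _; rewrite coef_map.
pose k := (size f).-1.
have [C C0 bndC] : exists2 C, 0 <= C & forall (u : nat -> F) i, (i < k)%N ->
    abs (iota (u i)) <= C * abs (\sum_(j < k) iota (u j) * t ^+ j).
  (* A relation among these powers would be a nonzero polynomial of degree below that of [f]
     vanishing at [t]. *)
  apply: coord_bounded => u sum0 i lik.
  pose a := \poly_(j < k) u j.
  have : root (a ^^ iota) t.
    rewrite /root (hornerE k) ?size_poly //.
    by under eq_bigr => j _ do rewrite coef_poly ltn_ord; rewrite sum0.
  move=> /minf fa; have [a0|nz_a] := eqVneq a 0.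
    by have := coef_poly k u i; rewrite -/a a0 coef0 lik.
  have := leq_trans (dvdp_leq nz_a fa) (size_poly _ _).
  by rewrite /k (polySpred nz_f) ltnn.
pose B := \sum_(j < k) abs (t' ^+ j).
have bnd (a : {poly F}) : abs (a ^^ iota).[t'] <= C * B * abs (a ^^ iota).[t].
  have modE s : root (f ^^ iota) s -> (a ^^ iota).[s] = ((a %% f) ^^ iota).[s].
    move=> fs; rewrite {1}(divp_eq a f) rmorphD rmorphM /= hornerD hornerM.
    by rewrite (rootP fs) mulr0 add0r.
  rewrite !modE ?ctt' //.
  have szr : (size (a %% f)%R <= k)%N by rewrite -ltnS -polySpred // ltn_modp.
  rewrite !(hornerE k) //; apply: abs_sum_le => [|j].
    by rewrite !mulr_ge0 ?sumr_ge0.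
  rewrite absM mulrAC; apply: ler_pM => //; first exact: bndC.
  by rewrite /B (bigD1 j) //= lerDl sumr_ge0.
apply: (@ler_of_expM_bound _ _ _ (C * B)) => // m.
by rewrite -!absX -!horner_exp -!rmorphXn; apply: bnd.
Qed.

End NonArchimedean.

(** * Power series with coefficients in a subfield *)

Section PowerSeriesCoefficients.
Variables (K : fieldType) (S : K -> Prop).
Hypothesis subS : is_subfield S.
Implicit Types f g : ps K.

Lemma subfield0 : S 0. Proof. by case: subS. Qed.
Lemma subfield1 : S 1. Proof. by case: subS => _ []. Qed.
Lemma subfieldD x y : S x -> S y -> S (x + y).
Proof. by case: subS => _ [_ [SD _]]; apply: SD. Qed.
Lemma subfieldN x : S x -> S (- x).
Proof. by case: subS => _ [_ [_ [SN _]]]; apply: SN. Qed.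
Lemma subfieldM x y : S x -> S y -> S (x * y).
Proof. by case: subS => _ [_ [_ [_ [SM _]]]]; apply: SM. Qed.
Lemma subfieldV x : S x -> S x^-1.
Proof.
have [->|nz_x] := eqVneq x 0; first by rewrite invr0.
by case: subS => _ [_ [_ [_ [_ SV]]]] Sx; apply: SV.
Qed.
Lemma subfieldX x n : S x -> S (x ^+ n).
Proof.
by move=> Sx; elim: n => [|n IHn]; rewrite ?expr0 ?exprS;
  [exact: subfield1 | exact: subfieldM].
Qed.
Lemma subfield_nat n : S n%:R.
Proof.
by elim: n => [|n IHn]; [exact: subfield0 | rewrite -natr1; apply/subfieldD/subfield1].
Qed.
Lemma subfield_sum I (r : seq I) (P : pred I) (u : I -> K) :
  (forall i, P i -> S (u i)) -> S (\sum_(i <- r | P i) u i).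
Proof. by move=> Su; apply: big_ind => //; [exact: subfield0 | exact: subfieldD]. Qed.

(** Only degrees below [n] are constrained, to allow induction on the degree. *)
Definition ps_over (n : nat) (f : ps K) := forall i j, (i + j < n)%N -> S (f i j).

Lemma ps_over_one n : ps_over n psone.
Proof. by move=> i j _; apply: subfield_nat. Qed.

Lemma ps_over_mul n f g : ps_over n f -> ps_over n g -> ps_over n (psmul f g).
Proof.
move=> Sf Sg i j ltn; apply: subfield_sum => a _; apply: subfield_sum => b _.
have := ltn_ord a; have := ltn_ord b; rewrite !ltnS => leb lea.
apply: subfieldM; [apply: Sf | apply: Sg]; apply: leq_ltn_trans ltn.
  exact: leq_add.
by rewrite leq_add ?leq_subr.
Qed.

Lemma ps_over_exp n f m : ps_over n f -> ps_over n (psexp f m).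
Proof.
by move=> Sf; elim: m => [|m IHm]; [exact: ps_over_one | exact: ps_over_mul].
Qed.

Lemma psmul_const f g : psmul f g 0 0 = f 0%N 0%N * g 0%N 0%N.
Proof. by rewrite /psmul !big_ord_recl !big_ord0 /= !addr0. Qed.

Lemma psexp_const f m : f 0%N 0%N = 0 -> psexp f m.+1 0%N 0%N = 0.
Proof. by move=> f0; rewrite /= psmul_const f0 mul0r. Qed.

(* Without constant terms, the degree-[n] part of [f * g] only involves the coefficients
   of [f] and [g] of degree less than [n]. *)
Lemma ps_over_mul_gain n f g : f 0%N 0%N = 0 -> g 0%N 0%N = 0 ->
  ps_over n f -> ps_over n g -> ps_over n.+1 (psmul f g).
Proof.
move=> f0 g0 Sf Sg i j; rewrite ltnS => len.
apply: subfield_sum => a _; apply: subfield_sum => b _.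
have := ltn_ord a; have := ltn_ord b; rewrite !ltnS => leb lea.
have [/eqP|abn0] := posnP (a + b).
  by rewrite addn_eq0 => /andP[/eqP-> /eqP->]; rewrite f0 mul0r; exact: subfield0.
have [/eqP|abn1] := posnP ((i - a) + (j - b)).
  by rewrite addn_eq0 => /andP[/eqP-> /eqP->]; rewrite g0 mulr0; exact: subfield0.
have E : (a + b + (i - a + (j - b)) = i + j)%N by rewrite addnACA !subnKC.
apply: subfieldM; [apply: Sf | apply: Sg]; apply: leq_trans len; rewrite -E.
  by rewrite -addn1 leq_add2l.
by rewrite -add1n leq_add2r.
Qed.

Lemma psmul1 f i j : psmul f psone i j = f i j.
Proof.
rewrite /psmul big_ord_recr /= [X in X + _]big1 ?add0r => [|a _]; last first.
  rewrite big1 // => b _; rewrite /psone subn_eq0 leqNgt ltn_ord /= mulr0 //.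
rewrite big_ord_recr /= [X in X + _]big1 ?add0r => [|b _].
  by rewrite /psone !subnn mulr1.
by rewrite /psone [X in _ && X]subn_eq0 [X in _ && X]leqNgt ltn_ord andbF mulr0.
Qed.

Lemma psmul1l f i j : psmul psone f i j = f i j.
Proof.
rewrite /psmul big_ord_recl /= [X in _ + X]big1 ?addr0 => [|a _]; last first.
  by rewrite big1 // => b _; rewrite /psone mul0r.
rewrite big_ord_recl /= [X in _ + X]big1 ?addr0 => [|b _].
  by rewrite /psone mul1r !subn0.
by rewrite /psone mul0r.
Qed.

(** Apart from [g1] and [g2], each monomial is 1 or a product of two series without constant term,
    where [ps_over_mul_gain] gains a degree. *)
Lemma ps_over_monomial n g1 g2 a b : g1 0%N 0%N = 0 -> g2 0%N 0%N = 0 ->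
  ps_over n g1 -> ps_over n g2 -> (a, b) != (1, 0)%N -> (a, b) != (0, 1)%N ->
  ps_over n.+1 (psmul (psexp g1 a) (psexp g2 b)).
Proof.
move=> g10 g20 S1 S2.
case: a b => [|a] [|b] //= ab1 ab2.
- by apply: ps_over_mul; apply: ps_over_one.
- case: b => // b in ab2 *.
  apply: ps_over_mul; first exact: ps_over_one.
  by apply: ps_over_mul_gain => //; [exact: psexp_const | exact: (@ps_over_exp _ _ b.+1)].
- case: a => // a in ab1 *.
  apply: ps_over_mul; last exact: ps_over_one.
  by apply: ps_over_mul_gain => //; [exact: psexp_const | exact: (@ps_over_exp _ _ a.+1)].
apply: ps_over_mul_gain.
- exact: (@psexp_const _ a).
- exact: (@psexp_const _ b).
- exact: (@ps_over_exp _ _ a.+1).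
- exact: (@ps_over_exp _ _ b.+1).
Qed.

(** Isolates the coefficients of [g1] and [g2] in degree [n], not yet known to lie in [S]: they
    enter only through the linear terms of [f]. *)
Lemma pscomp_linear_part n f g1 g2 i j : g1 0%N 0%N = 0 -> g2 0%N 0%N = 0 ->
  (forall a b, S (f a b)) -> ps_over n g1 -> ps_over n g2 -> (0 < i + j <= n)%N ->
  exists2 s, S s & pscomp f g1 g2 i j = f 1%N 0%N * g1 i j + f 0%N 1%N * g2 i j + s.
Proof.
move=> g10 g20 Sf S1 S2 /andP[lt0 len]; rewrite /pscomp.
pose T a b := f a b * psmul (psexp g1 a) (psexp g2 b) i j.
have T10 : T 1%N 0%N = f 1%N 0%N * g1 i j by rewrite /T /= !psmul1.
have T01 : T 0%N 1%N = f 0%N 1%N * g2 i j by rewrite /T psmul1l /= psmul1.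
have ST a b : (a, b) != (1, 0)%N -> (a, b) != (0, 1)%N -> S (T a b).
  move=> ab1 ab2; apply: subfieldM => //.
  by apply: (@ps_over_monomial n) => //; rewrite ltnS.
rewrite -/(T _ _) (eq_bigr (fun a : 'I_(i + j).+1 => \sum_(b < (i + j).+1) T a b)) //.
rewrite pair_bigA /=.
(* Positive degree ensures that the indices (1,0) and (0,1) occur in the double sum. *)
have l1 : (1 < (i + j).+1)%N by rewrite ltnS.
rewrite (bigD1 (Ordinal l1, ord0)) //= (bigD1 (ord0, Ordinal l1)) //= T10 T01 addrA.
eexists; last by congr (_ + _).
apply: subfield_sum => -[a b] /= /andP[n1 n2]; apply: ST.
  by apply: contraNneq n1 => -[a1 b0]; apply/eqP; congr (_, _); apply: val_inj.
by apply: contraNneq n2 => -[a1 b0]; apply/eqP; congr (_, _); apply: val_inj.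
Qed.

Lemma ps_over_pscomp f g1 g2 : (forall a b, S (f a b)) ->
  (forall a b, S (g1 a b)) -> (forall a b, S (g2 a b)) ->
  forall i j, S (pscomp f g1 g2 i j).
Proof.
move=> Sf S1 S2 i j; apply: subfield_sum => a _; apply: subfield_sum => b _.
apply: subfieldM => //.
by apply: (@ps_over_mul (i + j).+1); rewrite // => ? ?; apply: ps_over_exp.
Qed.

(** * The Lubin-Tate logarithm, its inverse and multiplication *)

Section LubinTate.
Variables p h1 h2 : nat.
Hypotheses (p_gt1 : (1 < p)%N) (h1_gt0 : (0 < h1)%N) (h2_gt0 : (0 < h2)%N).

Lemma LT_L1_over i j : S (LT_L1 p h1 h2 i j).
Proof.
by do 2?apply: subfieldD; do ?[apply: subfield_nat | apply: subfield_sum => k _];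
  apply: subfieldM; do ?[apply: subfield_nat | apply: subfieldX | apply: subfieldV].
Qed.

Lemma LT_L2_over i j : S (LT_L2 p h1 h2 i j).
Proof.
by do 2?apply: subfieldD; do ?[apply: subfield_nat | apply: subfield_sum => k _];
  apply: subfieldM; do ?[apply: subfield_nat | apply: subfieldX | apply: subfieldV].
Qed.

Let one_neq_expp m : (0 < m)%N -> (1 == p ^ m)%N = false.
Proof. by move=> m0; rewrite ltn_eqF // -{1}(expn0 p) ltn_exp2l. Qed.

(** The nonlinear exponents are [p ^ m] with [m > 0], never 1; with [LT_L2_linear], the linear part
    of the logarithm is the identity. *)
Lemma LT_L1_linear :
  LT_L1 p h1 h2 1%N 0%N = 1 :> K /\ LT_L1 p h1 h2 0%N 1%N = 0 :> K.
Proof.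
rewrite /LT_L1 big_nat1 big_geq // !big_ord_recl !big_ord0 /= !mul1n.
rewrite !one_neq_expp ?addn_gt0 ?h1_gt0 //.
by split; rewrite ?andbF !mul0r !addr0.
Qed.

Lemma LT_L2_linear :
  LT_L2 p h1 h2 1%N 0%N = 0 :> K /\ LT_L2 p h1 h2 0%N 1%N = 1 :> K.
Proof.
rewrite /LT_L2 big_nat1 big_geq // !big_ord_recl !big_ord0 /= !mul1n.
rewrite !one_neq_expp ?addn_gt0 ?h1_gt0 ?h2_gt0 //.
by split; rewrite ?andbF !mul0r !addr0.
Qed.

Lemma LT_Linv_over (G1 G2 : ps K) : LT_Linv p h1 h2 G1 G2 ->
  forall i j, S (G1 i j) /\ S (G2 i j).
Proof.
case=> G10 G20 LG1 LG2.
suff SG n : ps_over n G1 /\ ps_over n G2.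
  by move=> i j; have [S1 S2] := SG (i + j).+1; split; [apply: S1 | apply: S2].
elim: n => [|n [S1 S2]]; first by split.
suff SG i j : (i + j < n.+1)%N -> S (G1 i j) /\ S (G2 i j).
  by split=> i j /SG[].
rewrite ltnS => len; have [/eqP|lt0] := posnP (i + j).
  by rewrite addn_eq0 => /andP[/eqP-> /eqP->]; rewrite G10 G20; split; exact: subfield0.
have lt0n : (0 < i + j <= n)%N by rewrite lt0.
have [L110 L101] := LT_L1_linear; have [L210 L201] := LT_L2_linear.
split.
  have [s Ss] := pscomp_linear_part G10 G20 LT_L1_over S1 S2 lt0n.
  rewrite LG1 L110 L101 mul0r mul1r addr0 => /esym/(canRL (addrK _))->.
  by apply/subfieldD/subfieldN => //; apply: subfield_nat.
have [s Ss] := pscomp_linear_part G10 G20 LT_L2_over S1 S2 lt0n.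
rewrite LG2 L210 L201 mul0r mul1r add0r => /esym/(canRL (addrK _))->.
by apply/subfieldD/subfieldN => //; apply: subfield_nat.
Qed.

Lemma LT_mult_over a (P1 P2 : ps K) : S a -> LT_mult p h1 h2 a P1 P2 ->
  forall i j, S (P1 i j) /\ S (P2 i j).
Proof.
move=> Sa [G1 [G2 [/LT_Linv_over SG DP1 DP2]]] i j; rewrite DP1 DP2.
have SL1 k l : S (psscale a (LT_L1 p h1 h2) k l) by apply/subfieldM/LT_L1_over.
have SL2 k l : S (psscale a (LT_L2 p h1 h2) k l) by apply/subfieldM/LT_L2_over.
by split; apply: ps_over_pscomp => // k l; case: (SG k l).
Qed.

End LubinTate.
End PowerSeriesCoefficients.

(** * The field generated by a set *)

Section GeneratedField.
Variables (K : fieldType) (Q T : K -> Prop).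

Lemma gen_field_subfield : is_subfield (gen_field Q T).
Proof.
refine (conj _ (conj _ (conj _ (conj _ (conj _ _))))) => [S subS _ _|S subS _ _
  |x y Ex Ey S subS QS TS|x Ex S subS QS TS|x y Ex Ey S subS QS TS|x Ex _ S subS QS TS].
- exact: subfield0 subS.
- exact: subfield1 subS.
- by apply: (subfieldD subS); [apply: Ex | apply: Ey].
- by apply: (subfieldN subS); apply: Ex.
- by apply: (subfieldM subS); [apply: Ex | apply: Ey].
- by apply: (subfieldV subS); apply: Ex.
Qed.

Lemma gen_field_base x : Q x -> gen_field Q T x.
Proof. by move=> Qx S _ QS _; apply: QS. Qed.

Lemma gen_field_gen x : T x -> gen_field Q T x.
Proof. by move=> Tx S _ _ TS; apply: TS. Qed.

End GeneratedField.

(** * Polynomials over [Q] as images of polynomials over [F] *)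

Section SubfieldImage.
Variables (F K : fieldType) (iota : {rmorphism F -> K}) (Q : K -> Prop).
Hypothesis iotaP : forall x, Q x <-> exists a, x = iota a.

Lemma polyOv_map (q : {poly F}) : polyOv Q (q ^^ iota).
Proof. by move=> i; rewrite coef_map; apply/iotaP; exists q`_i. Qed.

Lemma polyOvP (q : {poly K}) : polyOv Q q -> exists q1 : {poly F}, q = q1 ^^ iota.
Proof.
move=> Qq; have /choice[c cE] : forall i, exists a, q`_i = iota a.
  by move=> i; apply/iotaP.
exists (\poly_(i < size q) c i); apply/polyP => i.
rewrite coef_map coef_poly; case: ltnP => [_|le]; first exact: cE.
by rewrite nth_default //= rmorph0.
Qed.

(** The gcd of [q1] and [r] vanishes at [x], so it is not constant. Irreducibility makes its
    cofactor in [q1] constant, so [y] is a root of the gcd, hence of [r]. *)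
Lemma irreducible_conjugate (q : {poly K}) x y :
  irreducible_over Q q -> root q x -> root q y -> conjugate iota x y.
Proof.
case=> /polyOvP[q1 ->] sz irr qx qy r rx.
have nz_q : q1 != 0 by rewrite -(map_poly_eq0 iota) -size_poly_gt0 ltnW.
have /dvdpP[u Dq] := dvdp_gcdl q1 r; have /dvdpP[v Dr] := dvdp_gcdr q1 r.
have gx : root (gcdp q1 r ^^ iota) x by rewrite gcdp_map root_gcd qx rx.
have [//|||sz1|sz1] := irr (u ^^ iota) (gcdp q1 r ^^ iota).
- exact: polyOv_map.
- exact: polyOv_map.
- by rewrite -rmorphM -Dq.
- have /size_poly1P[c nz_c uE] : size u == 1%N by rewrite -sz1 size_map_poly.
  move: qy; rewrite Dq uE rmorphM /= rootM map_polyC rootC fmorph_eq0 (negPf nz_c).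
  by move=> gy; rewrite Dr rmorphM /= rootM [X in _ || X]gy orbT.
by have := root_size_gt1 _ gx; rewrite sz1 map_poly_eq0 gcdp_eq0 (negPf nz_q) => /(_ isT).
Qed.

Lemma separable_annihilator x : [pchar F] =i pred0 -> algebraicOver iota x ->
  exists q : {poly K}, [/\ polyOv Q q, root q x & coprimep q q^`()].
Proof.
move=> ch0 /minimal_poly_exists[f [nz_f fx minf]].
exists (f ^^ iota); split=> //; first exact: polyOv_map.
by rewrite deriv_map coprimep_map (minimal_poly_separable ch0 nz_f fx).
Qed.

End SubfieldImage.

(** * Elements whose conjugates all lie in [E] *)

Section Normality.
Variables (F : fieldType) (K : closedFieldType) (iota : {rmorphism F -> K}).
Variables (Q E : K -> Prop).
Hypothesis iotaP : forall x, Q x <-> exists a, x = iota a.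
Hypothesis subE : is_subfield E.
Hypothesis pchar0 : [pchar F] =i pred0.
Hypothesis alg : forall x : K, algebraicOver iota x.

(** Keeping the generator [t] makes closure under field operations a matter of choosing a common
    generator; [lift_conjugate] recovers all conjugates of [x]. *)
Definition conj_stable (x : K) := exists t (a : {poly F}),
  x = (a ^^ iota).[t] /\ forall t', conjugate iota t t' -> E (a ^^ iota).[t'].

(** A primitive element [t] for both generators works: conjugates of [t] induce conjugates of [tx]
    and [ty]. *)
Lemma conj_stable2 x y : conj_stable x -> conj_stable y ->
  exists t (a b : {poly F}), [/\ x = (a ^^ iota).[t], y = (b ^^ iota).[t] &
   forall t', conjugate iota t t' -> E (a ^^ iota).[t'] /\ E (b ^^ iota).[t']].
Proof.
move=> [tx [ax [Dx Ex]]] [ty [ay [Dy Ey]]].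
have [t [a [b [Da Db]]]] := primitive_element_pair pchar0 (alg tx) (alg ty).
exists t, (ax \Po a), (ay \Po b); rewrite !map_horner_comp Da Db; split=> // t' ctt'.
by rewrite !map_horner_comp; split; [apply: Ex; rewrite -Da | apply: Ey; rewrite -Db];
  apply: conjugate_horner.
Qed.

Lemma conj_stable_base x : Q x -> (forall y, Q y -> E y) -> conj_stable x.
Proof.
move=> Qx QE; have [a Da] := (iotaP x).1 Qx; exists 0, a%:P.
by rewrite map_polyC hornerC /= -Da; split=> // t' _; rewrite hornerC; apply: QE.
Qed.

Lemma conj_stable_subfield : (forall y, Q y -> E y) -> is_subfield conj_stable.
Proof.
move=> QE; refine (conj _ (conj _ (conj _ (conj _ (conj _ _))))).
- by apply: conj_stable_base => //; apply/iotaP; exists 0; rewrite rmorph0.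
- by apply: conj_stable_base => //; apply/iotaP; exists 1; rewrite rmorph1.
- move=> x y sx sy; have [t [a [b [-> -> Eab]]]] := conj_stable2 sx sy.
  exists t, (a + b); rewrite rmorphD hornerD; split=> // t' /Eab[Ea Eb].
  by rewrite hornerD; apply: subfieldD.
- move=> _ [t [a [-> Ea]]]; exists t, (- a); rewrite rmorphN hornerN; split=> // t'.
  by move/Ea => Ea'; rewrite hornerN; apply: subfieldN.
- move=> x y sx sy; have [t [a [b [-> -> Eab]]]] := conj_stable2 sx sy.
  exists t, (a * b); rewrite rmorphM hornerM; split=> // t' /Eab[Ea Eb].
  by rewrite hornerM; apply: subfieldM.
move=> _ [t [a [-> Ea]]] nz; have [b ab1] := horner_inv (alg t) nz.
(* The relation [a * b - 1 = 0] at [t] persists at every conjugate [t'], so [b] gives the inverse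
   there too. *)
have invE s : ((a * b) ^^ iota).[s] = 1 -> (a ^^ iota).[s]^-1 = (b ^^ iota).[s].
  rewrite rmorphM hornerM => ab1s; have nza : (a ^^ iota).[s] != 0.
    by apply/eqP => a0; move/eqP: ab1s; rewrite a0 mul0r eq_sym oner_eq0.
  by apply: (mulfI nza); rewrite ab1s mulfV.
exists t, b; split=> [|t' ctt']; first exact: invE.
rewrite -invE; first by apply: (subfieldV subE); apply: Ea.
have := ctt' (a * b - 1); rewrite /root rmorphB rmorph1 !hornerD !hornerN !hornerC.
by rewrite ab1 subrr eqxx => /(_ isT); rewrite subr_eq0 => /eqP.
Qed.

Lemma conj_stable_splits q : irreducible_over Q q ->
  (exists x, conj_stable x /\ root q x) -> splits_in E q.
Proof.
move=> irr [_ [[t [a [-> Ea]]] qx]].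
have [rs Dq] := closed_field_poly_normal q.
exists (lead_coef q), rs; split; last by rewrite mul_polyC.
move=> y yrs; have qy : root q y.
  have nzl : lead_coef q != 0.
    by case: irr => _ sz _; rewrite lead_coef_eq0 -size_poly_gt0 ltnW.
  by rewrite Dq rootZ // root_prod_XsubC.
have [t' ctt' <-] := lift_conjugate (alg t) (irreducible_conjugate iotaP irr qx qy).
exact: Ea.
Qed.

End Normality.

(** * Conjugates of torsion points and the torsion field *)

Lemma pspart_map (F K : fieldType) (iota : {rmorphism F -> K}) (f : ps K)
    (g : nat -> nat -> F) (a b : {poly F}) N : (forall i j, f i j = iota (g i j)) ->
  exists c : {poly F}, forall t,
    pspart f (a ^^ iota).[t] (b ^^ iota).[t] N = (c ^^ iota).[t].
Proof.
move=> fE; exists (\sum_(i < N.+1) \sum_(j < (N - i).+1) (g i j)%:P * a ^+ i * b ^+ j).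
move=> t; rewrite rmorph_sum horner_sum; apply: eq_bigr => i _.
rewrite rmorph_sum horner_sum; apply: eq_bigr => j _.
by rewrite !rmorphM !rmorphXn /= map_polyC !hornerM !horner_exp hornerC fE.
Qed.

Theorem theorem5p1 (R : realType) (K : closedFieldType) (abs : K -> R) (Q : K -> Prop)
    (p h1 h2 : nat) :
  prime p -> (0 < h1)%N -> (0 < h2)%N -> coprime h1 h2 ->
  Qp_closure abs Q p ->
  forall n : nat, (1 <= n)%N ->
    galois_over Q (LT_torsion_field abs Q p h1 h2 n).
Proof.
move=> p_pr h1_gt0 h2_gt0 _ [chK [[abs_ge0 abs_eq0] [absM [absD [subQ rest]]]]] n _.
case: rest => _ [complQ [_ algQ]].
have [F [iota iotaP]] := subfield_fieldType subQ.
have chF : [pchar F] =i pred0.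
  by move=> q; rewrite -chK -(fmorph_pchar iota).
have alg x : algebraicOver iota x.
  have [q1 [nz_q Qq qx]] := algQ x; have [q Dq] := polyOvP iotaP Qq.
  by exists q; rewrite -?(map_poly_eq0 iota) -Dq.
have complete (u : nat -> F) :
  (forall eps : R, 0 < eps -> exists N, forall m n, (N <= m)%N -> (N <= n)%N ->
     abs (iota (u m) - iota (u n)) < eps) ->
  exists l, forall eps : R, 0 < eps -> exists N, forall n, (N <= n)%N ->
     abs (iota (u n) - iota l) < eps.
  move=> cau; have [|l [/iotaP[a ->] lP]] := complQ (fun n => iota (u n)) _ cau.
    by move=> k; apply/iotaP; exists (u k).
  by exists a.
pose T y := exists x1 x2, LT_torsion abs p h1 h2 n x1 x2 /\ (y = x1 \/ y = x2).
pose E := LT_torsion_field abs Q p h1 h2 n.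
have subE : is_subfield E := gen_field_subfield Q T.
have QE x : Q x -> E x by apply: gen_field_base.
have absle := conjugate_abs_le abs_ge0 abs_eq0 absM absD complete.
have torsion_conj (a b : {poly F}) t t' : conjugate iota t t' ->
    LT_torsion abs p h1 h2 n (a ^^ iota).[t] (b ^^ iota).[t] ->
    LT_torsion abs p h1 h2 n (a ^^ iota).[t'] (b ^^ iota).[t'].
  move=> ctt' [abs1 abs2 [P1 [P2 [mulP zero1 zero2]]]].
  have SP := LT_mult_over subQ (prime_gt1 p_pr) h1_gt0 h2_gt0 (subfield_nat subQ _) mulP.
  have zero (P : ps K) : (forall i j, Q (P i j)) ->
      ps_eval_zero abs P (a ^^ iota).[t] (b ^^ iota).[t] ->
      ps_eval_zero abs P (a ^^ iota).[t'] (b ^^ iota).[t'].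
    move=> QP zP eps /zP[M HM]; exists M => N /HM; apply: le_lt_trans.
    have /choice[g gE] : forall i, exists g : nat -> F, forall j, P i j = iota (g j).
      move=> i; have /choice[g gE] : forall j, exists a, P i j = iota a.
        by move=> j; apply/iotaP.
      by exists g.
    (* The partial sums at [t] and [t'] are values of one polynomial [c] over [F], so convergence to
       0 passes from [t] to [t']. *)
    by have [c cE] := pspart_map a b N gE; rewrite !cE; apply: absle.
  split; [exact: le_lt_trans (absle _ _ _ (alg t) ctt') abs1
    | exact: le_lt_trans (absle _ _ _ (alg t) ctt') abs2 |].
  by exists P1, P2; split=> //; apply: zero => // i j; case: (SP i j).
have stable x : E x -> conj_stable iota E x.
  (* [E] is the smallest subfield containing [Q] and the torsion coordinates, so it lies in the
     subfield of stable elements once these do. *)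
  apply; [exact: conj_stable_subfield | by move=> y Qy; apply: conj_stable_base |].
  move=> y [x1 [x2 [tors yE]]].
  (* One [t] for both coordinates: a conjugate [t'] must move the point as a pair for it to remain
     torsion. *)
  have [t [a [b [Da Db]]]] := primitive_element_pair chF (alg x1) (alg x2).
  have Et' t' : conjugate iota t t' -> E (a ^^ iota).[t'] /\ E (b ^^ iota).[t'].
    move=> ctt'; have tors' : LT_torsion abs p h1 h2 n (a ^^ iota).[t'] (b ^^ iota).[t'].
      by apply: torsion_conj ctt' _; rewrite Da Db.
    by split; apply: gen_field_gen; exists (a ^^ iota).[t'], (b ^^ iota).[t'];
      split=> //; [left | right].
  by case: yE => ->; [exists t, a | exists t, b]; split=> // t' /Et'[].
split=> // [x _|q irr [x [Ex qx]]].
  exact: separable_annihilator.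
by apply: (conj_stable_splits iotaP alg irr); exists x; split=> //; apply: stable.
Qed.
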